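(* Let $\mathbb{X}$ be a real ordered vector space, $x,y\in\mathbb{X}$ with $x\le y$, let $\mathbb{Y}$ be a vector lattice, and let $f,g:[x,y]\to\mathbb{Y}$ be functions of bounded variation. Then: (1) $f$ is bounded. (2) For every $\alpha\in\mathbb{R}$, $\alpha f$ is of bounded variation and $\mathcal{V}(\alpha f)=|\alpha|\,\mathcal{V}(f)$. In particular, $-f$ is of bounded variation with $\mathcal{V}(-f)=\mathcal{V}(f)$. Moreover, if $\mathbb{Y}$ is Dedekind complete, then: (3) $f\pm g$ is of bounded variation and $\mathcal{V}(f\pm g)\le \mathcal{V}(f)+\mathcal{V}(g)$ (for each choice of sign). (4) The function $|f|$, $|f|(z)=|f(z)|$, is of bounded variation and $\mathcal{V}(|f|)\le\mathcal{V}(f)$.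
   Context: A real ordered vector space is a real vector space $\mathbb{X}$ with a cone $\mathbb{X}^+$ (non-empty, closed under addition and under multiplication by non-negative reals); $u\le v$ means $v-u\in\mathbb{X}^+$, and $u<v$ means $u\le v$ and $u\neq v$. For $x\le y$, $[x,y]=\{z\in\mathbb{X}: x\le z\le y\}$. A partition $\mathcal{P}$ of $[x,y]$ is a finite chain $x=x_0<x_1<\cdots<x_{n_{\mathcal P}}=y$ of points of $[x,y]$. In a vector lattice $\mathbb{Y}$, $|u|=u\vee(-u)$. $\mathbb{Y}$ is Dedekind complete if every non-empty subset that is bounded above has a supremum in $\mathbb{Y}$. For $f:[x,y]\to\mathbb{Y}$ put $\Sigma_{\mathcal P}[f]=\sum_{i=1}^{n_{\mathcal P}}|f(x_i)-f(x_{i-1})|$. The function $f$ is of bounded variation if $\mathcal{V}(f)=\sup\{\Sigma_{\mathcal P}[f]:\mathcal P \text{ a partition of }[x,y]\}$ exists in $\mathbb{Y}$; $\mathcal{V}(f)$ is then called the total variation. A function $f$ is bounded if its image $f([x,y])$ is bounded above and bounded below in the order of $\mathbb{Y}$ (equivalently, there is $w\in\mathbb{Y}$ with $|f(z)|\le w$ for all $z\in[x,y]$). *)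

(* Defs.v *)
From HB Require Import structures.
From mathcomp Require Import all_boot all_order all_algebra.
From mathcomp Require Import boolp classical_sets reals.

Set Implicit Arguments.
Unset Strict Implicit.
Unset Printing Implicit Defensive.

Import Order.TTheory GRing.Theory Num.Theory.
Local Open Scope classical_set_scope.
Local Open Scope ring_scope.

(* C is not required to be pointed, so cone_le is only a preorder
   compatible with the vector space structure. *)
Definition is_cone (R : realType) (X : lmodType R) (C : set X) : Prop :=
  [/\ C !=set0,
      forall u v, C u -> C v -> C (u + v) &
      forall (a : R) u, 0 <= a -> C u -> C (a *: u)].

Section cone_order.
Context {R : realType} {X : lmodType R}.
Implicit Types (C : set X) (u v x y z : X).

Definition cone_le C u v : Prop := C (v - u).

Definition cone_lt C u v : Prop := cone_le C u v /\ u <> v.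

Definition cone_itv C x y : set X := [set z | cone_le C x z /\ cone_le C z y].

(* The sequence s = [:: x_1; ...; x_n] encodes the chain
   x = x_0 < x_1 < ... < x_n = y; n = 0 is allowed, and forces x = y. *)
Definition cone_partition C x y (s : seq X) : Prop :=
  [/\ path (fun u v => `[< cone_lt C u v >]) x s,
      last x s = y &
      forall z, z \in s -> cone_itv C x y z].

End cone_order.

HB.mixin Record POrderedZmodule_isVectorLattice (R : realType) (Y : Type)
    of GRing.Lmodule R Y & Num.POrderedZmodule Y := {
  vlat_leD2r : forall u v w : Y, u <= v -> u + w <= v + w ;
  vlat_scale_ge0 : forall (a : R) (u : Y), 0 <= a -> 0 <= u -> 0 <= a *: u ;
  vlat_has_join : forall u v : Y, supremums [set u; v] !=set0 ;
  vlat_has_meet : forall u v : Y, infimums [set u; v] !=set0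
}.

(* MathComp's latticeType cannot be joined with lmodType by HB outside the
   library (the join with realDomainType is missing), so the lattice operations
   are obtained as suprema and infima in the underlying partial order. *)
#[short(type="vectorLatticeType")]
HB.structure Definition VectorLattice (R : realType) :=
  { Y of GRing.Lmodule R Y & Num.POrderedZmodule Y
       & POrderedZmodule_isVectorLattice R Y }.

Section vector_lattice.
Context {R : realType} {Y : vectorLatticeType R}.
Implicit Types u v : Y.

Definition vlat_join u v : Y := supremum 0 [set u; v].

Definition vlat_abs u : Y := vlat_join u (- u).

End vector_lattice.

Definition dedekind_complete (R : realType) (Y : vectorLatticeType R) : Prop :=
  forall A : set Y, A !=set0 -> has_ubound A -> supremums A !=set0.

(* Functions on [x, y] are represented by total functions on X; bounded
   variation, total variation and boundedness depend only on their values on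
   cone_itv C x y, which contains all points of a partition. *)
Section variation.
Context {R : realType} {X : lmodType R} {Y : vectorLatticeType R}.
Implicit Types (C : set X) (x y : X) (f : X -> Y).

Definition cone_variation x f (s : seq X) : Y :=
  \sum_(i < size s) vlat_abs (f (nth x s i) - f (nth x (x :: s) i)).

Definition cone_variations C x y f : set Y :=
  [set cone_variation x f s | s in cone_partition C x y].

Definition cone_BV C x y f : Prop :=
  supremums (cone_variations C x y f) !=set0.

(* Equal to 0 by convention if f is not of bounded variation. *)
Definition cone_TV C x y f : Y := supremum 0 (cone_variations C x y f).

Definition order_bounded_on C x y f : Prop :=
  has_ubound (f @` cone_itv C x y) /\ has_lbound (f @` cone_itv C x y).

End variation.

(* Main.v *)
Require Import Defs.
From HB Require Import structures.
From mathcomp Require Import all_boot all_order all_algebra.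
From mathcomp Require Import boolp classical_sets reals.

Set Implicit Arguments.
Unset Strict Implicit.
Unset Printing Implicit Defensive.

Import Order.TTheory GRing.Theory Num.Theory.
Local Open Scope classical_set_scope.
Local Open Scope ring_scope.

(** The absolute value of a vector lattice behaves like a norm: it is
absolutely homogeneous ([vlat_absZ]), subadditive ([vlat_absD]), and hence
satisfies the reverse triangle inequality ([vlat_abs_dist]).  Each of these
follows from the universal property of [|u|] as the least upper bound of [u]
and [- u].

Applied termwise to the increments of a function along a partition, these
properties compare the variation sums of [a *: f], [f + g] and [|f|] with those
of [f] and [g], and the claims on total variations follow by taking suprema.
For [a *: f] the sums are scaled by [|a|], and a supremum is carried along by
this scaling in any vector lattice ([supremums_scale]).  For [f + g] and [|f|]
the comparison only bounds the sums above, so a supremum exists by Dedekind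
completeness ([cone_BV_dominated]); the case of [f - g] is that of [f + (- g)].

Boundedness holds because every [z] in the interval belongs to some partition,
so that [|f z - f x|] is at most the total variation ([le_cone_TV]). *)

(** * Suprema and order in a vector lattice *)

Lemma supremum_eq d (T : porderType d) (x0 v : T) (A : set T) :
  A !=set0 -> supremums A v -> supremum x0 A = v.
Proof.
move=> /set0P A0 Av; rewrite /supremum (negbTE A0).
case: xgetP => [w _ Aw|/(_ v) //]; exact: is_subset1_supremums Aw Av.
Qed.

Section vector_lattice_order.
Context {R : realType} {Y : vectorLatticeType R}.
Implicit Types (u v w : Y) (c : R) (A : set Y).

Lemma vlat_leB2r w u v : (u - w <= v - w) = (u <= v).
Proof.
apply/idP/idP => [/(vlat_leD2r _ _ w)|]; first by rewrite !subrK.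
exact: vlat_leD2r.
Qed.

Lemma vlat_leD u1 v1 u2 v2 : u1 <= v1 -> u2 <= v2 -> u1 + u2 <= v1 + v2.
Proof.
move=> h1 h2; apply: le_trans (vlat_leD2r _ _ u2 h1) _.
by rewrite ![v1 + _]addrC; exact: vlat_leD2r.
Qed.

Lemma vlat_le_sum (I : finType) (F G : I -> Y) :
  (forall i, F i <= G i) -> \sum_i F i <= \sum_i G i.
Proof.
move=> FG; apply: (big_ind2 (fun a b : Y => a <= b)) => //.
by move=> *; exact: vlat_leD.
Qed.

Lemma vlat_leZ c u v : 0 <= c -> u <= v -> c *: u <= c *: v.
Proof.
move=> c0 uv; rewrite -(vlat_leB2r (c *: u)) subrr -scalerBr.
by apply: vlat_scale_ge0 => //; rewrite -(subrr u) vlat_leB2r.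
Qed.

(** A positive dilation is an order isomorphism, so it preserves suprema; for
[c = 0] the image is [{0}], which is why [A] must be non-empty. *)
Lemma supremums_scale c A v : A !=set0 -> 0 <= c -> supremums A v ->
  supremums [set c *: u | u in A] (c *: v).
Proof.
move=> [a Aa] c0 [ubv lbv]; split=> [_ [u Au <-]|w ubw].
  by apply: vlat_leZ => //; exact: ubv.
have [c_eq0|c_neq0] := eqVneq c 0.
  have := ubw _ (imageP ( *:%R c) Aa).
  by rewrite /= c_eq0 !scale0r.
have wE : w = c *: (c^-1 *: w) by rewrite scalerA divff // scale1r.
rewrite wE; apply: vlat_leZ => //; apply: lbv => u Au.
rewrite -[u]scale1r -(mulVf c_neq0) -scalerA.
apply: vlat_leZ; first by rewrite invr_ge0.
by apply: ubw; exists u.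
Qed.

(** * The absolute value of a vector lattice *)

Lemma vlat_abs_sup u : supremums [set u; - u] (vlat_abs u).
Proof.
have [v uv] := vlat_has_join u (- u).
suff -> : vlat_abs u = v by [].
by apply: supremum_eq => //; exists u; left.
Qed.

Lemma vlat_le_abs u : u <= vlat_abs u.
Proof. by have [ub _] := vlat_abs_sup u; apply: ub; left. Qed.

Lemma vlat_leN_abs u : - u <= vlat_abs u.
Proof. by have [ub _] := vlat_abs_sup u; apply: ub; right. Qed.

Lemma vlat_abs_le u w : u <= w -> - u <= w -> vlat_abs u <= w.
Proof.
by move=> uw Nuw; have [_ lb] := vlat_abs_sup u; apply: lb => _ [->|->].
Qed.

(** Adding [u <= |u|] and [- u <= |u|] gives [0 <= 2 |u|]. *)
Lemma vlat_abs_ge0 u : 0 <= vlat_abs u.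
Proof.
have := vlat_leD (vlat_le_abs u) (vlat_leN_abs u).
rewrite subrr => /(vlat_scale_ge0 (2^-1 : R) _).
rewrite -mulr2n -scaler_nat scalerA mulVf ?pnatr_eq0 // scale1r.
by apply; rewrite invr_ge0 ler0n.
Qed.

Lemma vlat_abs0 : vlat_abs (0 : Y) = 0.
Proof.
by apply/eqP; rewrite eq_le vlat_abs_ge0 andbT vlat_abs_le ?oppr0.
Qed.

Lemma vlat_absD u v : vlat_abs (u + v) <= vlat_abs u + vlat_abs v.
Proof.
apply: vlat_abs_le; first by apply: vlat_leD; exact: vlat_le_abs.
by rewrite opprD; apply: vlat_leD; exact: vlat_leN_abs.
Qed.

Lemma vlat_absZ c u : vlat_abs (c *: u) = `|c| *: vlat_abs u.
Proof.
have le_scale (a : R) (v : Y) : a *: v <= `|a| *: vlat_abs v.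
  have [a0|/ltW a0] := leP 0 a.
    by rewrite ger0_norm //; apply: vlat_leZ (vlat_le_abs v).
  rewrite ler0_norm // -[a *: v]opprK -scaleNr -scalerN.
  by apply: vlat_leZ (vlat_leN_abs v); rewrite oppr_ge0.
have abs_le (a : R) (v : Y) : vlat_abs (a *: v) <= `|a| *: vlat_abs v.
  apply: vlat_abs_le => //; rewrite -scaleNr -normrN; exact: le_scale.
apply/eqP; rewrite eq_le abs_le /=.
have [->|c0] := eqVneq c 0; first by rewrite normr0 !scale0r vlat_abs_ge0.
(* The reverse inequality is [abs_le] for [c^-1], since [u = c^-1 (c u)]. *)
have /(vlat_leZ (normr_ge0 c)) := abs_le c^-1 (c *: u).
by rewrite !scalerA mulVf // scale1r -normrM divff // normr1 scale1r.
Qed.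

Lemma vlat_absN u : vlat_abs (- u) = vlat_abs u.
Proof. by rewrite -scaleN1r vlat_absZ normrN1 scale1r. Qed.

Lemma vlat_abs_dist u v :
  vlat_abs (vlat_abs u - vlat_abs v) <= vlat_abs (u - v).
Proof.
have half (a b : Y) : vlat_abs a - vlat_abs b <= vlat_abs (a - b).
  rewrite -[leRHS](addrK (vlat_abs b)) vlat_leB2r.
  by rewrite -{1}[a](subrK b) vlat_absD.
apply: vlat_abs_le; first exact: half.
by rewrite opprB -(vlat_absN (u - v)) opprB; exact: half.
Qed.

End vector_lattice_order.

(** * Variation sums and total variation *)

Section total_variation.
Context {R : realType} {X : lmodType R} {Y : vectorLatticeType R}.
Variables (C : set X) (hC : is_cone C) (x y : X) (hxy : cone_le C x y).
Implicit Types (f g h : X -> Y) (z : X) (s : seq X).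

Lemma cone_le_refl z : cone_le C z z.
Proof.
case: hC => -[u Cu] _ /(_ 0 u (lexx _) Cu).
by rewrite scale0r /cone_le subrr.
Qed.

Lemma cone_variation_ge0 f s : 0 <= cone_variation x f s.
Proof.
apply: (big_ind (fun w : Y => 0 <= w)) => // [u v u0 v0|i _].
  by rewrite -[0]addr0 vlat_leD.
exact: vlat_abs_ge0.
Qed.

Lemma cone_variationZ (a : R) f s :
  cone_variation x (fun z => a *: f z) s = `|a| *: cone_variation x f s.
Proof.
rewrite /cone_variation scaler_sumr; apply: eq_bigr => i _.
by rewrite -scalerBr vlat_absZ.
Qed.

Lemma cone_variationD f g s :
  cone_variation x (fun z => f z + g z) s
    <= cone_variation x f s + cone_variation x g s.
Proof.
rewrite /cone_variation -big_split /=; apply: vlat_le_sum => i.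
by rewrite opprD addrACA vlat_absD.
Qed.

Lemma cone_variation_abs f s :
  cone_variation x (fun z => vlat_abs (f z)) s <= cone_variation x f s.
Proof. by apply: vlat_le_sum => i; exact: vlat_abs_dist. Qed.

Lemma cone_partition_exists : exists s, cone_partition C x y s.
Proof.
have [xy|/eqP x_neq_y] := eqVneq x y.
  by exists [::]; split.
exists [:: y]; split=> //= [|z]; first by rewrite andbT; apply/asboolP.
by rewrite inE => /eqP ->; split=> //; exact: cone_le_refl.
Qed.

(** The witness is the chain through [z], namely [x < z < y], shortened when
[z] is one of the endpoints. *)
Lemma cone_variation_ge_dist f z : cone_itv C x y z ->
  exists2 s, cone_partition C x y s &
    vlat_abs (f z - f x) <= cone_variation x f s.
Proof.
move=> [xz zy]; have [->|/eqP z_neq_x] := eqVneq z x.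
  have [s sP] := cone_partition_exists; exists s => //.
  by rewrite subrr vlat_abs0 cone_variation_ge0.
have x_lt_z : cone_lt C x z by split=> // /esym.
have [zyE|/eqP z_neq_y] := eqVneq z y.
  exists [:: z]; last by rewrite /cone_variation big_ord1.
  split=> //= [|t]; first by rewrite andbT; apply/asboolP.
  by rewrite inE => /eqP ->.
exists [:: z; y].
  split=> //= [|t]; first by rewrite andbT; apply/andP; split; apply/asboolP.
  rewrite !inE => /orP[] /eqP -> //.
  by split=> //; exact: cone_le_refl.
rewrite /cone_variation !big_ord_recl big_ord0 /= addr0 -[leLHS]addr0.
by apply: vlat_leD => //; exact: vlat_abs_ge0.
Qed.

Lemma cone_variations_neq0 f : cone_variations C x y f !=set0.
Proof.
have [s sP] := cone_partition_exists.
by exists (cone_variation x f s); exists s.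
Qed.

Lemma cone_TV_sup f : cone_BV C x y f ->
  supremums (cone_variations C x y f) (cone_TV C x y f).
Proof.
move=> [v fv]; suff -> : cone_TV C x y f = v by [].
by apply: supremum_eq => //; exact: cone_variations_neq0.
Qed.

Lemma cone_TV_eq f v : supremums (cone_variations C x y f) v ->
  cone_BV C x y f /\ cone_TV C x y f = v.
Proof.
by move=> fv; split; [exists v|apply: supremum_eq (cone_variations_neq0 f) fv].
Qed.

Lemma cone_variation_le_TV f s : cone_BV C x y f -> cone_partition C x y s ->
  cone_variation x f s <= cone_TV C x y f.
Proof. by move=> /cone_TV_sup[ub _] sP; apply: ub; exists s. Qed.

Lemma le_cone_TV f z : cone_BV C x y f -> cone_itv C x y z ->
  vlat_abs (f z - f x) <= cone_TV C x y f.
Proof.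
move=> hf /(cone_variation_ge_dist f)[s sP le_s].
by apply: le_trans le_s _; exact: cone_variation_le_TV.
Qed.

Lemma cone_BV_bounded f : cone_BV C x y f -> order_bounded_on C x y f.
Proof.
move=> hf; split.
  exists (cone_TV C x y f + f x) => _ [z zP <-].
  rewrite -(vlat_leB2r (f x)) addrK.
  exact: le_trans (vlat_le_abs _) (le_cone_TV hf zP).
exists (f x - cone_TV C x y f) => _ [z zP <-].
have /(vlat_leD2r _ _ (f z - cone_TV C x y f)) : f x - f z <= cone_TV C x y f.
  rewrite -opprB; exact: le_trans (vlat_leN_abs _) (le_cone_TV hf zP).
by rewrite addrA subrK addrCA subrr addr0.
Qed.

Lemma cone_TVZ (a : R) f : cone_BV C x y f ->
  cone_BV C x y (fun z => a *: f z) /\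
  cone_TV C x y (fun z => a *: f z) = `|a| *: cone_TV C x y f.
Proof.
move=> hf; apply: cone_TV_eq.
rewrite (_ : cone_variations _ _ _ _ =
             [set `|a| *: u | u in cone_variations C x y f]); last first.
  rewrite /cone_variations image_comp; apply: eq_imagel => s _ /=.
  exact: cone_variationZ.
apply: supremums_scale; first exact: cone_variations_neq0.
- exact: normr_ge0.
- exact: cone_TV_sup.
Qed.

Lemma cone_TVN f : cone_BV C x y f ->
  cone_BV C x y (fun z => - f z) /\
  cone_TV C x y (fun z => - f z) = cone_TV C x y f.
Proof.
move=> /(cone_TVZ (-1)); rewrite normrN1 scale1r.
by under eq_fun do rewrite scaleN1r.
Qed.

Lemma cone_BV_dominated h w : dedekind_complete Y ->
  (forall s, cone_partition C x y s -> cone_variation x h s <= w) ->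
  cone_BV C x y h /\ cone_TV C x y h <= w.
Proof.
move=> dY hw.
have ubw : ubound (cone_variations C x y h) w by move=> _ [s sP <-]; exact: hw.
have hBV : cone_BV C x y h.
  by apply: dY; [exact: cone_variations_neq0|exists w].
by split=> //; have [_] := cone_TV_sup hBV; exact.
Qed.

Lemma cone_TVD f g : dedekind_complete Y ->
  cone_BV C x y f -> cone_BV C x y g ->
  cone_BV C x y (fun z => f z + g z) /\
  cone_TV C x y (fun z => f z + g z) <= cone_TV C x y f + cone_TV C x y g.
Proof.
move=> dY hf hg; apply: cone_BV_dominated => // s sP.
apply: le_trans (cone_variationD f g s) _.
by apply: vlat_leD; exact: cone_variation_le_TV.
Qed.

Lemma cone_TV_abs f : dedekind_complete Y -> cone_BV C x y f ->
  cone_BV C x y (fun z => vlat_abs (f z)) /\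
  cone_TV C x y (fun z => vlat_abs (f z)) <= cone_TV C x y f.
Proof.
move=> dY hf; apply: cone_BV_dominated => // s sP.
exact: le_trans (cone_variation_abs f s) (cone_variation_le_TV hf sP).
Qed.

End total_variation.

Theorem theorem3p4 (R : realType) (X : lmodType R) (C : set X)
    (hC : is_cone C) (x y : X) (hxy : cone_le C x y)
    (Y : vectorLatticeType R) (f g : X -> Y)
    (hf : cone_BV C x y f) (hg : cone_BV C x y g) :
  [/\ order_bounded_on C x y f,
      (forall a : R,
         cone_BV C x y (fun z => a *: f z) /\
         cone_TV C x y (fun z => a *: f z) = `|a| *: cone_TV C x y f) /\
      (cone_BV C x y (fun z => - f z) /\
       cone_TV C x y (fun z => - f z) = cone_TV C x y f) &
      dedekind_complete Y ->
      [/\ cone_BV C x y (fun z => f z + g z) /\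
          cone_TV C x y (fun z => f z + g z)
            <= cone_TV C x y f + cone_TV C x y g,
          cone_BV C x y (fun z => f z - g z) /\
          cone_TV C x y (fun z => f z - g z)
            <= cone_TV C x y f + cone_TV C x y g &
          cone_BV C x y (fun z => vlat_abs (f z)) /\
          cone_TV C x y (fun z => vlat_abs (f z)) <= cone_TV C x y f]].
Proof.
split; first exact: cone_BV_bounded.
  by split=> [a|]; [exact: cone_TVZ|exact: cone_TVN].
move=> dY; split; first exact: cone_TVD.
  have [hNg <-] := cone_TVN hC hxy hg; exact: cone_TVD.
exact: cone_TV_abs.
Qed.
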